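(* Let $1\le k\le n$ be integers and let $C\subseteq S_n$ be the set of the first $k$ rows of a Latin square of order $n$. Then $$r(C)\ge n-\left\lfloor \frac nk\right\rfloor .$$ Furthermore, if $k$ is even, $k$ divides $n$, and $C$ consists of the first $k$ rows of the cyclic Latin square of order $n$, then $r(C)\ge n-\frac nk+1$. Consequently, for integers $n\ge1$ and $0\le t\le n$: if $n-t+1$ divides $\frac n2$, then $m(S_n,t)\le \frac{n}{n-t+1}$; and if $n-t+1$ does not divide $\frac n2$ and $t\le n-1$, then $m(S_n,t)\le \left\lfloor\frac{n}{n-t+1}\right\rfloor+1$.
   Context: $S_n$ is the symmetric group on $\{1,\dots,n\}$, acting on the right, with the Hamming distance $d(\pi,\sigma)=|\{i : i\pi\neq i\sigma\}|$. For a nonempty subset $C\subseteq S_n$, the remoteness of $C$ is $r(C)=\min_{v\in S_n}\max_{c\in C} d(v,c)$. For an integer $t$, $m(S_n,t)$ denotes the minimum cardinality of a nonempty $C\subseteq S_n$ with $r(C)\ge t$ (taken to be $+\infty$ if no such $C$ exists). A Latin square of order $n$ is an $n\times n$ array over $\{1,\dots,n\}$ in which every element appears exactly once in each row and each column; each row is viewed as a permutation $\pi\in S_n$ whose word $1\pi,2\pi,\dots,n\pi$ is that row. The cyclic Latin square of order $n$ has first row $1,2,\dots,n$, and each subsequent row is obtained from the previous one by a cyclic shift to the left. ''$n-t+1$ divides $\frac n2$'' means that $\frac{n}{2}$ is an integer multiple of $n-t+1$; in particular it fails whenever $n$ is odd. *)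

(* Defs.v *)
From mathcomp Require Import all_boot all_order all_fingroup all_algebra.
From mathcomp Require Import constructive_ereal.

Set Implicit Arguments.
Unset Strict Implicit.
Unset Printing Implicit Defensive.

Import Order.TTheory GRing.Theory Num.Theory.

(* The points {1, ..., n} are represented by 'I_n, that is,
   {0, ..., n - 1}; [s i] is the right action i s. *)

Definition hamming (n : nat) (s u : 'S_n) : nat := #|[set i | s i != u i]|.

Definition max_dist (n : nat) (C : {set 'S_n}) (v : 'S_n) : nat :=
  \max_(c in C) hamming v c.

(* Only meaningful for nonempty [C]: the empty maximum is 0. *)
Definition remoteness (n : nat) (C : {set 'S_n}) : nat :=
  max_dist C [arg min_(v < 1%g) max_dist C v].

(* The minimum over an empty family of codes is +oo. *)
Definition min_card (n t : nat) : \bar rat :=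
  \big[mine/+oo%E]_(C : {set 'S_n} | (C != set0) && (t <= remoteness C))
    (#|C|%:R%R)%:E%E.

Definition latin_square (n : nat) (L : 'M['I_n]_n) : Prop :=
  (forall i x : 'I_n, exists! j : 'I_n, L i j = x) /\
  (forall j x : 'I_n, exists! i : 'I_n, L i j = x).

(* The permutations whose word is one of the rows 0, ..., k - 1 of [L]; every
   row of a Latin square is the word of exactly one permutation. *)
Definition first_rows (n : nat) (L : 'M['I_n]_n) (k : nat) : {set 'S_n} :=
  [set s : 'S_n | [exists i : 'I_n, (i < k) && [forall j, s j == L i j]]].

(* [ordS j] is j + 1 modulo n. *)
Definition shift_left (n : nat) (w : 'I_n -> 'I_n) : 'I_n -> 'I_n :=
  fun j => w (ordS j).

Definition cyclic_square (n : nat) : 'M['I_n]_n :=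
  \matrix_(i < n, j < n) iter i (@shift_left n) id j.

(* d divides the rational number n / 2, which need not be an integer. *)
Definition divides_half (d n : nat) : Prop :=
  exists q : int, (n%:R / 2 = q%:~R * d%:R :> rat)%R.

(* Main.v *)
Require Import Defs.
From mathcomp Require Import all_boot all_order all_fingroup all_algebra.
From mathcomp Require Import constructive_ereal.
From mathcomp Require Import zify.

(** A permutation [v] is far from a row of a Latin square exactly when it
    agrees with that row in few columns, so lower bounds on remoteness are
    upper bounds on the least number of agreements.  In each column [v] agrees
    with exactly one row of the whole square, hence the numbers of agreements
    with the [n] rows add up to [n] ([sum_agreements]); among the first [k]
    rows one row therefore has at most [n %/ k] agreements
    ([exists_few_agreements]).

    When [k] divides [n], all of the first [k] rows have at least [n %/ k]
    agreements only if each of them agrees with [v] exactly [n %/ k] times and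
    the other rows never do ([agreements_tight]).  In the cyclic square, whose
    row [i] is the translation by [i], this cannot happen for even [k]: sending
    each column [j] to [v j] translates it by the index of the row met there,
    and since [v] is a permutation these translations add up to 0 modulo [n]
    ([dvdn_sum_agreements_cyclic]); but in the tight case they add up to
    [n %/ k * 'C(k, 2)], which is [n / 2] modulo [n].

    The bounds on the minimum cardinality follow by taking [k] rows of the
    cyclic square.  Write [d] for [n - t + 1].  If [n / 2] is a multiple of
    [d], then [k = n / d] is even and [n - n / k + 1 = t]; otherwise
    [k = n %/ d + 1] satisfies [n %/ k < d], that is [t <= n - n %/ k]. *)

Set Implicit Arguments.
Unset Strict Implicit.
Unset Printing Implicit Defensive.

Import Order.TTheory GRing.Theory Num.Theory.

(** * Remoteness and minimum cardinality *)

Lemma leq_remoteness n (C : {set 'S_n}) t :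
  (forall v, exists2 c, c \in C & t <= hamming v c) -> t <= remoteness C.
Proof.
move=> far; rewrite /remoteness; set v := arg_min _ _ _.
have [c cC le_t] := far v.
by apply: leq_trans le_t _; apply: leq_bigmax_cond.
Qed.

Lemma min_card_le n t (C : {set 'S_n}) :
  C != set0 -> t <= remoteness C -> (min_card n t <= (#|C|%:R%R)%:E)%E.
Proof.
by move=> C0 tC; rewrite /min_card; apply: bigmin_le_cond; rewrite C0.
Qed.

Lemma hamming_agree n (v s : 'S_n) :
  hamming v s = n - #|[set j | v j == s j]|.
Proof.
rewrite -[X in X - _]card_ord -(cardsC [set j | v j == s j]) addKn.
by apply: eq_card => j; rewrite !inE.
Qed.

(** * Rows of a Latin square *)

Lemma latin_row_inj n (L : 'M['I_n]_n) i : latin_square L -> injective (L i).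
Proof.
move=> [rowL _] j1 j2 eqL; have [j [_ uniq_j]] := rowL i (L i j2).
by rewrite -(uniq_j j1 eqL) -(uniq_j j2).
Qed.

Lemma latin_col_inj n (L : 'M['I_n]_n) j :
  latin_square L -> injective (L^~ j).
Proof.
move=> [_ colL] i1 i2 eqL; have [i [_ uniq_i]] := colL j (L i2 j).
by rewrite -(uniq_i i1 eqL) -(uniq_i i2).
Qed.

Lemma latin_unique_row n (L : 'M['I_n]_n) j x :
  latin_square L -> exists i, forall i', (x == L i' j) = (i' == i).
Proof.
move=> latL; have [i [<- _]] := latL.2 j x; exists i => i'.
by rewrite (inj_eq (latin_col_inj latL)) eq_sym.
Qed.

Definition row_as_perm n (L : 'M['I_n]_n) (latL : latin_square L) i : 'S_n :=
  perm (@latin_row_inj n L i latL).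

Lemma first_rowsE n (L : 'M['I_n]_n) (latL : latin_square L) k :
  first_rows L k = row_as_perm latL @: [set i : 'I_n | i < k].
Proof.
apply/setP => s; rewrite inE; apply/existsP/imsetP.
  case=> i /andP [ltik /forallP sE]; exists i; first by rewrite inE.
  by apply/permP => j; rewrite permE; apply/eqP.
case=> i; rewrite inE => ltik ->; exists i; rewrite ltik.
by apply/forallP => j; rewrite permE.
Qed.

Lemma card_first_rows n (L : 'M['I_n]_n) k :
  latin_square L -> k <= n -> #|first_rows L k| = k.
Proof.
move=> latL lekn; rewrite (first_rowsE latL) card_imset => [|i1 i2 /permP eqL].
  by rewrite -sum1_card (eq_bigl (fun i : 'I_n => i < k)) =>
    [|i]; rewrite ?inE // -(big_ord_widen n (fun=> 1)) // sum1_card card_ord.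
(* Any column separates two rows; [i1] serves as a column index. *)
by have := eqL i1; rewrite !permE; apply: latin_col_inj.
Qed.

(** * Agreements with the rows of a Latin square *)

Definition agreements n (L : 'M['I_n]_n) (v : 'S_n) (i : 'I_n) : nat :=
  #|[set j | v j == L i j]|.

Lemma leq_remoteness_first_rows n (L : 'M['I_n]_n) k t :
    latin_square L ->
    (forall v, exists2 i : 'I_n, i < k & t <= n - agreements L v i) ->
  t <= remoteness (first_rows L k).
Proof.
move=> latL far; apply: leq_remoteness => v; have [i ltik le_t] := far v.
exists (row_as_perm latL i).
  by rewrite (first_rowsE latL) imset_f // inE.
rewrite hamming_agree; congr (_ <= _ - _): le_t.
by apply: eq_card => j; rewrite !inE permE.
Qed.

(** Double counting of the pairs (row, column) where [L] agrees with [v]. Weight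
    1 gives the total number of agreements; in the cyclic square, the weight
    [i] of row [i] gives the total displacement of [v]. *)
Lemma sum_agreements_weighted n (L : 'M['I_n]_n) (v : 'S_n) (w : 'I_n -> nat) :
  \sum_i w i * agreements L v i = \sum_j \sum_(i | v j == L i j) w i.
Proof.
rewrite (exchange_big_dep predT) //=; apply: eq_bigr => i _.
rewrite sum_nat_const mulnC; congr (_ * _).
by apply: eq_card => j; rewrite !inE.
Qed.

Lemma sum_agreements n (L : 'M['I_n]_n) (v : 'S_n) :
  latin_square L -> \sum_i agreements L v i = n.
Proof.
move=> latL; have := sum_agreements_weighted L v (fun=> 1).
under eq_bigr do rewrite mul1n.
move=> ->; transitivity (\sum_(j < n) 1); last by rewrite sum1_card card_ord.
apply: eq_bigr => j _; have [i eqi] := latin_unique_row j (v j) latL.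
by rewrite (big_pred1 i).
Qed.

Lemma sum_first_const n k c : k <= n -> \sum_(i < n | i < k) c = k * c.
Proof.
by move=> lekn; rewrite -(big_ord_widen n (fun=> c)) // sum_nat_const card_ord.
Qed.

(** Otherwise the first [k] rows alone would have at least
    [k * (n %/ k).+1 > n] agreements. *)
Lemma exists_few_agreements n (L : 'M['I_n]_n) k (v : 'S_n) :
    latin_square L -> 1 <= k -> k <= n ->
  exists2 i : 'I_n, i < k & agreements L v i <= n %/ k.
Proof.
move=> latL k0 lekn.
have [/exists_inP [i ltik few]|] :=
  boolP [exists (i : 'I_n | i < k), agreements L v i <= n %/ k].
  by exists i.
rewrite negb_exists => /forallP many.
suff: k * (n %/ k).+1 <= n by rewrite leqNgt mulnC ltn_ceil.
rewrite -{2}(sum_agreements v latL) (bigID (fun i : 'I_n => i < k)) /=.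
rewrite -(sum_first_const _ lekn).
apply: leq_trans (leq_addr _ _); apply: leq_sum => i ltik.
by have := many i; rewrite negb_and ltik -ltnNge.
Qed.

(** The total [n] of all agreements equals [k * (n %/ k)], the sum of the lower
    bounds [n %/ k] on the first [k] rows and 0 on the others; so none of these
    bounds is strict. *)
Lemma agreements_tight n (L : 'M['I_n]_n) k (v : 'S_n) :
    latin_square L -> k <= n -> k %| n ->
    (forall i : 'I_n, i < k -> n %/ k <= agreements L v i) ->
  forall i, agreements L v i = if i < k then n %/ k else 0.
Proof.
move=> latL lekn dvdkn many i.
have le_a (j : 'I_n) : (if j < k then n %/ k else 0) <= agreements L v j.
  by case: ifP => // /many.
have := leqif_sum (fun j (_ : predT j) => leqif_eq (le_a j)).
case=> _; rewrite sum_agreements // -big_mkcond sum_first_const //.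
by rewrite mulnC divnK // eqxx => /esym /forallP /(_ i) /eqP.
Qed.

(** * The cyclic square *)

Lemma cyclic_squareE n (i j : 'I_n) : cyclic_square n i j = (j + i) %% n :> nat.
Proof.
rewrite mxE; elim: (i : nat) (j) => [|m IHm] j' /=.
  by rewrite addn0 modn_small.
by rewrite /shift_left IHm /= modnDml addSnnS.
Qed.

Lemma inj_exists_unique n (f : 'I_n -> 'I_n) :
  injective f -> forall x, exists! j, f j = x.
Proof.
move=> f_inj x; have [g _ gK] := injF_bij f_inj.
by exists (g x); split=> [|j <-]; [exact: gK | apply: f_inj; exact: gK].
Qed.

Lemma cyclic_square_latin n : latin_square (cyclic_square n).
Proof.
split=> a; apply: inj_exists_unique => b1 b2 /(congr1 val) /=;
  rewrite !cyclic_squareE => /eqP; rewrite ?eqn_modDl ?eqn_modDr;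
  by rewrite !modn_small // => /eqP /val_inj.
Qed.

(** The total displacement of a permutation of the integers modulo [n] is 0,
    because the sums of its arguments and of its values coincide; and [v]
    displaces column [j] by the index of the row it agrees with there. *)
Lemma dvdn_sum_agreements_cyclic n (v : 'S_n) :
  n %| \sum_(i < n) i * agreements (cyclic_square n) v i.
Proof.
rewrite (sum_agreements_weighted _ _ (fun i : 'I_n => i)).
set D := \sum_j _; rewrite /dvdn -[X in _ == X](mod0n n).
rewrite -(eqn_modDl (\sum_(j < n) j)) addn0 /D -big_split /=.
rewrite [X in _ == X %[mod n]](reindex_inj (@perm_inj _ v)) /=.
apply/eqP; rewrite -[LHS]modn_summ -[RHS]modn_summ.
congr (_ %% n); apply: eq_bigr => j _.
have [i eqi] := latin_unique_row j (v j) (cyclic_square_latin n).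
have /eqP vj : v j == cyclic_square n i j by rewrite eqi.
by rewrite (big_pred1 i) // vj cyclic_squareE modn_mod.
Qed.

(** Writing [n = m * k] and cancelling [m], this says that an even [k] does not
    divide [k * k.-1 / 2], because [k.-1] is odd. *)
Lemma ndvdn_bin2_mul n k :
  0 < n -> ~~ odd k -> k %| n -> ~~ (n %| 'C(k, 2) * (n %/ k)).
Proof.
move=> n0 evenk /dvdnP [m eqn]; move: n0.
rewrite {n}eqn muln_gt0 => /andP [m0 k0].
rewrite mulnK // [X in _ %| X]mulnC dvdn_pmul2l // bin2.
rewrite -(even_halfK evenk) in k0 *; move: k./2 k0 => q.
rewrite double_gt0 -doubleMl doubleK -{1}muln2 => q0.
by rewrite dvdn_pmul2l // dvdn2 -subn1 oddB ?double_gt0 // odd_double.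
Qed.

(** If there were no such row, [agreements_tight] would give the weighted sum of
    [dvdn_sum_agreements_cyclic] the value ['C(k, 2) * (n %/ k)]. *)
Lemma exists_fewer_agreements_cyclic n k (v : 'S_n) :
    1 <= k -> k <= n -> ~~ odd k -> k %| n ->
  exists2 i : 'I_n, i < k & agreements (cyclic_square n) v i < n %/ k.
Proof.
move=> k0 lekn evenk dvdkn.
have [/exists_inP [i ltik few]|] :=
  boolP [exists (i : 'I_n | i < k), agreements (cyclic_square n) v i < n %/ k].
  by exists i.
rewrite negb_exists => /forallP many.
have tight := agreements_tight (cyclic_square_latin n) lekn dvdkn.
have {many} /tight {}tight (i : 'I_n) :
    i < k -> n %/ k <= agreements (cyclic_square n) v i.
  by move=> ltik; have := many i; rewrite negb_and ltik -leqNgt.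
have := dvdn_sum_agreements_cyclic v.
under eq_bigr do rewrite tight (fun_if (muln _)) muln0.
rewrite -big_mkcond -(big_ord_widen n (fun i => i * (n %/ k))) //=.
rewrite -big_distrl /= -(big_mkord predT id) bin2_sum.
by rewrite (negPf (ndvdn_bin2_mul (leq_trans k0 lekn) evenk dvdkn)).
Qed.

(** * The bounds *)

Lemma remoteness_first_rows n (L : 'M['I_n]_n) k :
    latin_square L -> 1 <= k -> k <= n ->
  n - n %/ k <= remoteness (first_rows L k).
Proof.
move=> latL k0 lekn; apply: leq_remoteness_first_rows => // v.
have [i ltik few] := exists_few_agreements v latL k0 lekn.
by exists i => //; apply: leq_sub2l.
Qed.

Lemma remoteness_first_rows_cyclic n k :
    1 <= k -> k <= n -> ~~ odd k -> k %| n ->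
  n - n %/ k + 1 <= remoteness (first_rows (cyclic_square n) k).
Proof.
move=> k0 lekn evenk dvdkn.
apply: leq_remoteness_first_rows (cyclic_square_latin n) _ => v.
have [i ltik few] := exists_fewer_agreements_cyclic v k0 lekn evenk dvdkn.
by exists i => //; have := leq_div n k; lia.
Qed.

Lemma min_card_le_cyclic n t k :
    1 <= k -> k <= n -> t <= remoteness (first_rows (cyclic_square n) k) ->
  (min_card n t <= (k%:R%R)%:E)%E.
Proof.
move=> k0 lekn far; have cardC := card_first_rows (cyclic_square_latin n) lekn.
by rewrite -[X in (X%:R)%R]cardC min_card_le // -card_gt0 cardC.
Qed.

Lemma divides_halfP d n :
  divides_half d n -> 0 < n -> exists2 q, 0 < q & n = q.*2 * d.
Proof.
case=> q eq_half n0.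
have eqn : (n%:Z = q * 2 * d%:Z)%R.
  apply: (@intr_inj rat); rewrite !rmorphM /= -!pmulrn.
  by rewrite mulrAC -eq_half divfK.
have q0 : (0 < q)%R by nia.
by exists `|q|%N; nia.
Qed.

Theorem proposition7 :
  (forall (n k : nat) (L : 'M['I_n]_n),
     1 <= k -> k <= n -> latin_square L ->
     n - n %/ k <= remoteness (first_rows L k)) /\
  (forall n k : nat,
     1 <= k -> k <= n -> ~~ odd k -> k %| n ->
     n - n %/ k + 1 <= remoteness (first_rows (cyclic_square n) k)) /\
  (forall n t : nat,
     1 <= n -> t <= n -> divides_half (n - t + 1) n ->
     (min_card n t <= (n%:R / (n - t + 1)%:R)%R%:E)%E) /\
  (forall n t : nat,
     1 <= n -> t <= n -> ~ divides_half (n - t + 1) n -> t <= n - 1 ->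
     (min_card n t <= ((n %/ (n - t + 1) + 1)%:R)%R%:E)%E).
Proof.
split; [|split; [|split]].
- by move=> n k L k0 lekn latL; apply: remoteness_first_rows.
- exact: remoteness_first_rows_cyclic.
- move=> n t n0 letn /divides_halfP /(_ n0) [q q0].
  set d := n - t + 1 => eqn.
  have d0 : 0 < d by rewrite /d addn1.
  have -> : (n%:R / d%:R = q.*2%:R :> rat)%R.
    by rewrite eqn natrM mulfK // pnatr_eq0 -lt0n.
  have k0 : 0 < q.*2 by rewrite double_gt0.
  have lekn : q.*2 <= n by rewrite eqn leq_pmulr.
  apply: min_card_le_cyclic => //.
  have divE : n %/ q.*2 = d by rewrite eqn mulKn.
  have -> : t = n - n %/ q.*2 + 1 by have := leq_div n q.*2; lia.
  by apply: remoteness_first_rows_cyclic; rewrite ?odd_double // eqn dvdn_mulr.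
- move=> n t n0 letn _ ltn1; set d := n - t + 1; set k := n %/ d + 1.
  have d1 : 1 < d by rewrite /d; lia.
  have k0 : 0 < k by rewrite /k addn1.
  have lekn : k <= n by rewrite /k addn1 ltn_Pdiv.
  apply: min_card_le_cyclic => //.
  apply: leq_trans (remoteness_first_rows (cyclic_square_latin n) k0 lekn).
  have : n %/ k < d.
    by rewrite ltn_divLR // /k addn1 mulnC ltn_ceil // ltnW.
  by rewrite /d; lia.
Qed.
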